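(* Let $s$ denote West's stack-sorting map. Then, as formal power series, \[\sum_{n\geq 1}\bigl|s^{-1}(\operatorname{Av}_n(132,312))\bigr|x^n=\sum_{n\geq 1}\bigl|s^{-1}(\operatorname{Av}_n(231,312))\bigr|x^n=\sum_{n\geq 1}\bigl|s^{-1}(\operatorname{Av}_n(132,231))\bigr|x^n=\frac{1-2x-\sqrt{1-4x-4x^2}}{4x}.\]
   Context: A permutation is an ordering of a finite set of positive integers written in one-line notation; $S_n$ is the set of permutations of $[n]=\{1,\dots,n\}$. The normalization of a permutation of length $n$ is the element of $S_n$ obtained by replacing the $i$-th smallest entry by $i$ for each $i$. A permutation $\sigma=\sigma_1\cdots\sigma_n$ contains a pattern $\tau\in S_m$ if there are indices $i_1<\cdots<i_m$ such that the normalization of $\sigma_{i_1}\cdots\sigma_{i_m}$ is $\tau$; otherwise it avoids $\tau$. $\operatorname{Av}_n(\tau^{(1)},\tau^{(2)},\ldots)$ is the set of permutations in $S_n$ avoiding all listed patterns. The stack-sorting map $s$ is defined recursively: $s$ sends the empty permutation to itself, and if $\pi$ is nonempty with largest entry $m$, write $\pi=LmR$ and set $s(\pi)=s(L)\,s(R)\,m$ (concatenation). For a set $A$ of permutations, $s^{-1}(A)$ is the set of all permutations $\sigma$ with $s(\sigma)\in A$. *)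

(* Defs.v *)
From mathcomp Require Import all_boot all_order all_algebra.
From mathcomp Require Import finmap.
From mathcomp Require Import zify ring.

Set Implicit Arguments.
Unset Strict Implicit.
Unset Printing Implicit Defensive.

Import GRing.Theory.

Local Open Scope nat_scope.

(* Permutations are words in one-line notation: duplicate-free sequences of
   positive integers. *)
Definition is_permutation (w : seq nat) : bool := uniq w && (0 \notin w).

Definition normalization (w : seq nat) : seq nat :=
  [seq (index x (sort leq w)).+1 | x <- w].

(* Masks of w are exactly the choices of indices i_1 < ... < i_m. *)
Definition contains (w t : seq nat) : bool :=
  [exists m : (size w).-tuple bool, normalization (mask m w) == t].

Definition avoids (w t : seq nat) : bool := ~~ contains w t.

Definition Av (n : nat) (pats : seq (seq nat)) : {fset seq nat} :=
  [fset w in permutations (iota 1 n) | all (avoids w) pats]%fset.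

(* The first argument bounds the recursion depth; see stack_sort_cat for the
   defining equation. *)
Fixpoint stack_sort_rec (k : nat) (w : seq nat) : seq nat :=
  match k, w with
  | k'.+1, _ :: _ =>
      let m := \max_(x <- w) x in
      let i := index m w in
      stack_sort_rec k' (take i w) ++ stack_sort_rec k' (drop i.+1 w) ++ [:: m]
  | _, _ => [::]
  end.

Definition stack_sort (w : seq nat) : seq nat := stack_sort_rec (size w) w.

Lemma mem_bigmax_seq (x : nat) (w : seq nat) : \max_(y <- x :: w) y \in x :: w.
Proof.
elim: w x => [|z w IHw] x; first by rewrite big_seq1 mem_head.
rewrite big_cons; have := IHw z; set M := \max_(_ <- _) _ => HM.
by rewrite inE; case: (leqP x M) => _; rewrite ?HM ?orbT ?eqxx.
Qed.

Lemma stack_sort_rec_ge (k : nat) (w : seq nat) :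
  size w <= k -> stack_sort_rec k w = stack_sort w.
Proof.
rewrite /stack_sort.
elim/ltn_ind: k w => -[|k] IHk [|x w] //= Hw.
set m := \max_(_ <- _) _; set t := (X in stack_sort_rec _ X ++ _).
set d := (X in _ ++ stack_sort_rec _ X ++ _).
have Hi : index m (x :: w) < (size w).+1.
  by rewrite -[X in _ < X]/(size (x :: w)) index_mem mem_bigmax_seq.
have Ht : size t <= size w by rewrite size_take /= Hi -ltnS.
have Hd : size d <= size w by rewrite size_drop /= leq_subr.
rewrite (IHk k) ?(leq_trans Ht) // (IHk k _ d) ?(leq_trans Hd) //.
by rewrite (IHk (size w) _ t) // (IHk (size w) _ d).
Qed.

Lemma stack_sort_cat (L R : seq nat) (m : nat) :
  all (ltn^~ m) L -> all (ltn^~ m) R ->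
  stack_sort (L ++ m :: R) = stack_sort L ++ stack_sort R ++ [:: m].
Proof.
move=> HL HR; set w := L ++ m :: R.
have Emax : \max_(x <- w) x = m.
  apply/eqP; rewrite eqn_leq; apply/andP; split; last first.
    by apply: (leq_bigmax_seq (F := id)); rewrite // mem_cat mem_head orbT.
  apply/bigmax_leqP_seq => x; rewrite mem_cat inE => /or3P[xL|/eqP->//|xR] _.
    exact: ltnW (allP HL _ xL).
  exact: ltnW (allP HR _ xR).
have NmL : m \notin L by apply/negP => /(allP HL); rewrite /= ltnn.
have Ei : index m w = size L.
  by rewrite index_cat (negbTE NmL) /= eqxx addn0.
have Ew : size w = (size L + size R).+1 by rewrite size_cat /= addnS.
rewrite [LHS]/stack_sort Ew.
have -> : stack_sort_rec (size L + size R).+1 w =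
  stack_sort_rec (size L + size R) (take (index (\max_(x <- w) x) w) w) ++
  stack_sort_rec (size L + size R) (drop (index (\max_(x <- w) x) w).+1 w) ++
  [:: \max_(x <- w) x].
  by rewrite /w; case: (L).
have Ed : drop (size L).+1 w = R.
  by rewrite /w -cat_rcons drop_size_cat ?size_rcons.
rewrite Emax Ei Ed /w take_size_cat //.
by rewrite !stack_sort_rec_ge ?leq_addr ?leq_addl.
Qed.

Lemma perm_stack_sort (w : seq nat) : perm_eq (stack_sort w) w.
Proof.
suff H k : size w <= k -> perm_eq (stack_sort_rec k w) w by apply: H.
elim: k w => [|k IHk] [|x w] // Hw.
set m := \max_(y <- x :: w) y; set i := index m (x :: w).
rewrite -[stack_sort_rec _ _]/(stack_sort_rec k (take i (x :: w)) ++
  stack_sort_rec k (drop i.+1 (x :: w)) ++ [:: m]).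
have Hm : m \in x :: w by apply: mem_bigmax_seq.
have Hi : i < size (x :: w) by rewrite /i index_mem.
have Hd : drop i (x :: w) = m :: drop i.+1 (x :: w).
  by rewrite (drop_nth 0) // nth_index.
rewrite -[X in perm_eq _ X](cat_take_drop i) Hd.
apply: perm_cat.
  by apply: IHk; rewrite size_take Hi -ltnS (leq_trans Hi).
rewrite cats1 perm_rcons perm_cons; apply: IHk.
by rewrite size_drop /= subSS (leq_trans (leq_subr _ _)).
Qed.

(* The preimage of a finite set A under s, among all permutations.  Since s
   only rearranges entries, it suffices to search the rearrangements of the
   members of A; see in_stack_preimage. *)
Definition stack_preimage (A : {fset seq nat}) : {fset seq nat} :=
  [fset w in flatten [seq permutations u | u <- A]
     | is_permutation w && (stack_sort w \in A)]%fset.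

Lemma in_stack_preimage (A : {fset seq nat}) (w : seq nat) :
  (w \in stack_preimage A) = is_permutation w && (stack_sort w \in A).
Proof.
rewrite !inE /=; case: (boolP (stack_sort w \in A)); rewrite ?andbF // => wA.
suff -> : w \in flatten [seq permutations u | u <- A] by [].
apply/flatten_mapP; exists (stack_sort w) => //.
by rewrite mem_permutations perm_sym perm_stack_sort.
Qed.

Local Open Scope ring_scope.

(* A formal power series is its sequence of coefficients. *)
Definition fps := nat -> rat.

Definition fps_of_poly (p : {poly rat}) : fps := fun n => p`_n.

Definition fps_sub (f g : fps) : fps := fun n => f n - g n.

Definition fps_scale (a : rat) (f : fps) : fps := fun n => a * f n.

Definition fps_mul (f g : fps) : fps :=
  fun n => \sum_(i < n.+1) f i * g (n - i)%N.

(* Division by x; a genuine quotient only when f has zero constant term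
   (fps_divXK). *)
Definition fps_divX (f : fps) : fps := fun n => f n.+1.

(* The first n coefficients r_0, r_1, ... of the square root of f, for f with
   constant term 1: r_0 = 1, and r_k is found by comparing the coefficients of
   x^k in r^2 = f. *)
Fixpoint fps_sqrt_coefs (f : fps) (n : nat) : seq rat :=
  if n is k.+1 then
    let r := fps_sqrt_coefs f k in
    rcons r (if k == 0%N then 1
             else (f k - \sum_(1 <= i < k) r`_i * r`_(k - i)) / 2)
  else [::].

Definition fps_sqrt (f : fps) : fps := fun n => (fps_sqrt_coefs f n.+1)`_n.

Lemma fps_divXK (f : fps) :
  f 0%N = 0 -> fps_mul (fps_of_poly 'X) (fps_divX f) =1 f.
Proof.
move=> f0 [|n]; rewrite /fps_mul /fps_of_poly /fps_divX.
  by rewrite big_ord1 coefX mul0r f0.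
rewrite !big_ord_recl !coefX /= mul0r add0r mul1r subSS subn0.
by rewrite big1 ?addr0 // => i _; rewrite coefX mul0r.
Qed.

Lemma size_fps_sqrt_coefs (f : fps) (n : nat) : size (fps_sqrt_coefs f n) = n.
Proof. by elim: n => //= n IHn; rewrite size_rcons IHn. Qed.

Lemma nth_fps_sqrt_coefs (f : fps) (n i : nat) :
  (i < n)%N -> (fps_sqrt_coefs f n)`_i = fps_sqrt f i.
Proof.
elim: n => // n IHn; rewrite ltnS leq_eqVlt => /orP[/eqP-> //|lt_in].
by rewrite [fps_sqrt_coefs _ _]/= nth_rcons size_fps_sqrt_coefs lt_in IHn.
Qed.

Lemma fps_sqrt0 (f : fps) : fps_sqrt f 0%N = 1.
Proof. by []. Qed.

Lemma fps_sqrtS (f : fps) (n : nat) : fps_sqrt f n.+1 =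
  (f n.+1 - \sum_(1 <= i < n.+1) fps_sqrt f i * fps_sqrt f (n.+1 - i)%N) / 2.
Proof.
set r := fps_sqrt_coefs f n.+1.
transitivity
  (rcons r ((f n.+1 - \sum_(1 <= i < n.+1) r`_i * r`_(n.+1 - i)) / 2))`_n.+1.
  by [].
rewrite nth_rcons size_fps_sqrt_coefs ltnn eqxx.
rewrite big_nat [in RHS]big_nat; congr ((_ - _) / _).
by apply: eq_bigr => i /andP[i1 i2]; rewrite !nth_fps_sqrt_coefs //; lia.
Qed.

Lemma fps_sqrt_sqr (f : fps) :
  f 0%N = 1 -> fps_mul (fps_sqrt f) (fps_sqrt f) =1 f.
Proof.
move=> f0 [|n]; rewrite /fps_mul; first by rewrite big_ord1 mulr1 f0.
rewrite -(big_mkord xpredT (fun i => fps_sqrt f i * fps_sqrt f (n.+1 - i)%N)).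
rewrite big_nat_recr //= big_ltn // subn0 subnn fps_sqrt0 fps_sqrtS.
by set S := \sum_(_ <= _ < _) _; field.
Qed.

(* The generating function \sum_(n >= 1) |s^{-1}(Av_n(pats))| x^n. *)
Definition stack_preimage_gf (pats : seq (seq nat)) : fps :=
  fun n => if n == 0%N then 0 else #|` stack_preimage (Av n pats)|%:R.

(* Main.v *)
(** Call fertility of a word the number of its preimages under [s].  Splitting a
   preimage at its largest entry shows that the fertility of [w m], for [m]
   larger than all entries of [w], is the sum over all factorisations [w = u v]
   of the products of the fertilities of [u] and [v]; a word that does not end
   with its maximum has fertility 0.

   In a word avoiding 312 the last entry is the maximum exactly when the last
   step is an ascent, so the fertility depends only on the ascent word.  Both
   Av_n(132, 312) and Av_n(231, 312) contain exactly one permutation for each of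
   the [2 ^ (n - 1)] ascent words: there are two ways to append a last entry, one
   creating an ascent and one a descent.  Summing the recursion over all ascent
   words gives [F = x (1 + 2 F + 2 F ^ 2)] for both classes.

   Av_n(132, 231) consists of the V-shaped permutations, built by placing
   2, 3, ..., n successively at the left or right end.  Let [c] be the Catalan
   series without its constant term and, for a code [b] of left/right choices,
   let [H_b] be the series whose coefficient of [q ^ j] is the fertility after [j]
   further choices "right".  Then [H_{b left} = c H_b], while [H_{b right}] is
   the shift of [H_b].  As [c = q (1 + c) ^ 2], these operations act on
   polynomials in [c] as the steps of a weighted Motzkin path, and a first-passage
   decomposition of these paths gives the same quadratic equation. *)
Require Import Defs.
From HB Require Import structures.
From mathcomp Require Import all_boot all_order all_algebra finmap zify ring boolp.
Set Implicit Arguments.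
Unset Strict Implicit.
Unset Printing Implicit Defensive.
Import GRing.Theory.
Local Open Scope ring_scope.

(** * The ring of formal power series *)

HB.instance Definition _ := gen_eqMixin fps.
HB.instance Definition _ := gen_choiceMixin fps.

Lemma fpsP (f g : fps) : f =1 g -> f = g.
Proof. exact: funext. Qed.

Lemma fps_addA : associative (fun f g : fps => (fun n => f n + g n) : fps).
Proof. by move=> f g h; apply: fpsP => n; rewrite addrA. Qed.
Lemma fps_addC : commutative (fun f g : fps => (fun n => f n + g n) : fps).
Proof. by move=> f g; apply: fpsP => n; rewrite addrC. Qed.
Lemma fps_add0 : left_id ((fun=> 0) : fps) (fun f g => (fun n => f n + g n)).
Proof. by move=> f; apply: fpsP => n; rewrite add0r. Qed.
Lemma fps_addN : left_inverse ((fun=> 0) : fps) (fun f => (fun n => - f n))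
  (fun f g => (fun n => f n + g n)).
Proof. by move=> f; apply: fpsP => n; rewrite addNr. Qed.
HB.instance Definition _ :=
  GRing.isZmodule.Build fps fps_addA fps_addC fps_add0 fps_addN.

(** A coefficient of a product sees only finitely many coefficients of the factors, so commutativity
    and associativity transfer from polynomials. *)
Lemma fps_mul_trunc (f g : fps) N n : (n < N)%N ->
  fps_mul f g n = ((\poly_(i < N) f i) * (\poly_(i < N) g i))`_n.
Proof.
move=> nN; rewrite coefM; apply: eq_bigr => i _.
by rewrite !coef_poly !ifT //; have := ltn_ord i; lia.
Qed.

Lemma fps_mulC : commutative fps_mul.
Proof. by move=> f g; apply: fpsP => n; rewrite !(fps_mul_trunc _ _ (ltnSn n)) mulrC. Qed.

Lemma fps_mulA : associative fps_mul.
Proof.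
move=> f g h; apply: fpsP => n.
pose t (e : fps) := \poly_(i < n.+1) e i.
transitivity ((t f * (t g * t h))`_n).
  rewrite coefM; apply: eq_bigr => i _; have := ltn_ord i => lt_in.
  rewrite (@fps_mul_trunc g h n.+1); last by lia.
  by rewrite coef_poly lt_in.
rewrite mulrA coefM; apply: eq_bigr => i _; have := ltn_ord i => lt_in.
rewrite (@fps_mul_trunc f g n.+1) // coef_poly ifT //; lia.
Qed.

Lemma fps_mul1 : left_id (fps_of_poly 1) fps_mul.
Proof.
move=> f; apply: fpsP => n.
rewrite /fps_mul /fps_of_poly big_ord_recl coef1 mul1r subn0 big1 ?addr0 // => i _.
by rewrite coef1 mul0r.
Qed.

Lemma fps_mulDl : left_distributive fps_mul +%R.
Proof.
move=> f g h; apply: fpsP => n; rewrite /fps_mul -[RHS]big_split /=.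
by apply: eq_bigr => i _; rewrite -mulrDl.
Qed.

Lemma fps_oner_neq0 : fps_of_poly 1 != 0 :> fps.
Proof. by apply/eqP => /(congr1 (fun f : fps => f 0%N)); rewrite /fps_of_poly coef1. Qed.

HB.instance Definition _ := GRing.Zmodule_isComNzRing.Build fps
  fps_mulA fps_mulC fps_mul1 fps_mulDl fps_oner_neq0.

Definition fpsX : fps := fps_of_poly 'X.

Lemma fpsD_coef (f g : fps) n : (f + g) n = f n + g n. Proof. by []. Qed.
Lemma fpsN_coef (f : fps) n : (- f) n = - f n. Proof. by []. Qed.
Lemma fpsM_coef (f g : fps) n : (f * g) n = \sum_(i < n.+1) f i * g (n - i)%N.
Proof. by []. Qed.
Lemma fps1_coef n : (1 : fps) n = (n == 0%N)%:R.
Proof. exact: coef1. Qed.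
Lemma fpsMn_coef (f : fps) k n : (f *+ k) n = f n *+ k.
Proof. by elim: k => // k IHk; rewrite !mulrS fpsD_coef IHk. Qed.
Lemma fpsX_mul0 (f : fps) : (fpsX * f) 0%N = 0.
Proof. by rewrite fpsM_coef big_ord1 /fpsX /fps_of_poly coefX mul0r. Qed.
Lemma fpsX_mulS (f : fps) n : (fpsX * f) n.+1 = f n.
Proof.
rewrite fpsM_coef !big_ord_recl /fpsX /fps_of_poly !coefX /= mul0r add0r mul1r.
by rewrite subSS subn0 big1 ?addr0 // => i _; rewrite coefX mul0r.
Qed.
Lemma fpsM_coef0 (f g : fps) : (f * g) 0%N = f 0%N * g 0%N.
Proof. by rewrite fpsM_coef big_ord1. Qed.

(** * Cancellation, square roots and the closed form *)

Lemma fps_mulfI (f g : fps) : f 0%N != 0 -> f * g = 0 -> g = 0.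
Proof.
move=> f0 fg0; apply: fpsP; elim/ltn_ind=> n IHn.
have := congr1 (fun h : fps => h n) fg0.
rewrite fpsM_coef big_ord_recl subn0 big1 => [|i _].
  by rewrite addr0 => /eqP; rewrite mulf_eq0 (negbTE f0) => /eqP.
by rewrite IHn ?mulr0 //=; have := ltn_ord i; rewrite /bump; lia.
Qed.

(** With [s = fps_sqrt f], the product of [s + r] and [s - r] is 0, and [s + r] cancels because its
    constant term is 2. *)
Lemma fps_sqrt_uniq (f r : fps) :
  f 0%N = 1 -> r 0%N = 1 -> r * r = f -> fps_sqrt f = r.
Proof.
move=> f0 r0 rrf; have ss : fps_sqrt f * fps_sqrt f = f.
  exact/fpsP/fps_sqrt_sqr.
apply/eqP; rewrite -subr_eq0; apply/eqP.
apply: (@fps_mulfI (fps_sqrt f + r)); first by rewrite fpsD_coef r0 fps_sqrt0.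
by rewrite mulrC -subr_sqr !expr2 ss rrf subrr.
Qed.

(** Completing the square: [r = 1 - 2x - 4xf] satisfies [r^2 = 1 - 4x - 4x^2 + 8x (x (1 + 2f + 2f^2)
    - f)], and the last term vanishes by the equation for [f]. *)
Lemma fps_quadratic_root (f : fps) :
  f = fpsX * (1 + 2%:R * f + 2%:R * f ^+ 2) ->
  f =1 fps_scale 4^-1 (fps_divX (fps_sub (fps_of_poly (1 - 2 *: 'X))
         (fps_sqrt (fps_of_poly (1 - 4 *: 'X - 4 *: 'X^2))))).
Proof.
move=> Ef n.
have EX k (P : {poly rat}) : fps_of_poly (P - k%:R *: 'X) =
    fps_of_poly P - k%:R * fpsX.
  apply: fpsP => i; rewrite fpsD_coef fpsN_coef mulr_natl fpsMn_coef.
  by rewrite /fps_of_poly coefB coefZ mulr_natl.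
have EX2 k (P : {poly rat}) : fps_of_poly (P - k%:R *: 'X^2) =
    fps_of_poly P - k%:R * fpsX ^+ 2.
  apply: fpsP => i; rewrite fpsD_coef fpsN_coef mulr_natl fpsMn_coef.
  rewrite /fps_of_poly coefB coefZ mulr_natl; congr (_ - _ *+ _).
  by case: i => [|i]; rewrite coefXn expr2 ?fpsX_mul0 ?fpsX_mulS // /fpsX /fps_of_poly coefX.
set r := 1 - 2%:R * fpsX - 4%:R * (fpsX * f).
have -> : fps_sqrt (fps_of_poly (1 - 4 *: 'X - 4 *: 'X^2)) = r.
  apply: fps_sqrt_uniq.
  - by rewrite /fps_of_poly !coefB !coefZ coef1 coefX coefXn.
  - by rewrite /r !(fpsD_coef, fpsN_coef) !mulr_natl !fpsMn_coef fpsX_mul0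
       fps1_coef /fpsX /fps_of_poly coefX !mul0rn !subr0.
  rewrite EX2 EX -[fps_of_poly 1]/(1 : fps) /r.
  have -> : (1 - 2%:R * fpsX - 4%:R * (fpsX * f)) *
    (1 - 2%:R * fpsX - 4%:R * (fpsX * f)) = 1 - 4%:R * fpsX - 4%:R * fpsX ^+ 2
    + 8%:R * fpsX * (fpsX * (1 + 2%:R * f + 2%:R * f ^+ 2) - f) by ring.
  by rewrite -Ef subrr mulr0 addr0.
rewrite /fps_scale /fps_divX /fps_sub EX -[fps_of_poly 1]/(1 : fps) /r.
rewrite !(fpsD_coef, fpsN_coef) !mulr_natl !fpsMn_coef fpsX_mulS.
by field.
Qed.

(** * Weighted paths *)

Lemma fps_divX_X (f : fps) : fps_divX (fpsX * f) = f.
Proof. by apply: fpsP => n; rewrite /fps_divX fpsX_mulS. Qed.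

Lemma fps_divXD (f g : fps) : fps_divX (f + g) = fps_divX f + fps_divX g.
Proof. by []. Qed.

(* The recursion counts weighted lattice paths of length [n] from height [k]: up
   2, level 2 and down 1 from a positive height, only up, with weight 1, from
   height 0; a path ending at height [h] is weighted by [c ^+ h]. *)
Fixpoint path_series (c : fps) (n k : nat) : fps :=
  if n is n'.+1 then
    if k is k'.+1 then
      2%:R * path_series c n' k.+1 + 2%:R * path_series c n' k
        + path_series c n' k'
    else path_series c n' 1
  else c ^+ k.

(** The map [g -> fps_divX g + c g] acts on powers of [c] as one path step:
    [fps_divX (c ^+ k.+1) = (1 + c)^2 c ^+ k] by the equation for [c], while [fps_divX 1 = 0]. Being
    linear, it passes through the later steps. *)
Lemma path_series_shift (c : fps) n k : c = fpsX * (1 + c) ^+ 2 ->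
  path_series c n.+1 k = fps_divX (path_series c n k) + c * path_series c n k.
Proof.
move=> Ec; elim: n k => [|n IHn] [|k].
- rewrite /= expr0 expr1 mulr1 -[LHS]add0r; congr (_ + _).
  by apply: fpsP => n; rewrite /fps_divX fps1_coef.
- rewrite -[path_series c 0 k.+1]/(c ^+ k.+1).
  have -> : fps_divX (c ^+ k.+1) = (1 + c) ^+ 2 * c ^+ k.
    by rewrite exprS [X in X * _]Ec -mulrA fps_divX_X.
  by rewrite /= !exprS; ring.
- exact: (IHn 1%N).
have E m : path_series c m.+1 k.+1 = 2%:R * path_series c m k.+2
  + 2%:R * path_series c m k.+1 + path_series c m k by [].
have D2 (f : fps) : fps_divX (2%:R * f) = 2%:R * fps_divX f.
  by rewrite !mulr_natl !mulr2n fps_divXD.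
rewrite [in RHS](E n) [LHS]E !IHn !fps_divXD !D2; ring.
Qed.

(** Each right-hand side carries a factor [fpsX], so coefficient [n.+1] depends linearly on
    coefficients up to [n], and all vanish by induction. *)
Lemma path_relation_trivial (f : fps) (Z : nat -> fps) :
  Z 0%N = fpsX * (2%:R * Z 1%N + 2%:R * (f * Z 0%N) + 2%:R * Z 0%N) ->
  (forall k, Z k.+1 = fpsX * (2%:R * Z k.+2 + 2%:R * Z k.+1 + Z k)) ->
  forall n k, Z k n = 0.
Proof.
move=> Z0 ZS; elim/ltn_ind=> -[|n] IHn [|k].
- by rewrite Z0 fpsX_mul0.
- by rewrite ZS fpsX_mul0.
- rewrite Z0 fpsX_mulS 2!fpsD_coef !mulr_natl !fpsMn_coef !IHn // fpsM_coef.
  rewrite big1 => [|i _]; first by rewrite !mul0rn !addr0.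
  by rewrite IHn ?mulr0 //; lia.
by rewrite ZS fpsX_mulS 2!fpsD_coef !mulr_natl !fpsMn_coef !IHn // !mul0rn !addr0.
Qed.

Lemma path_series_root (c f : fps) (T : nat -> fps) :
  c = fpsX * (1 + c) ^+ 2 ->
  f = fpsX * (1 + 2%:R * f + 2%:R * f ^+ 2) ->
  T 0%N = (1 + c) ^+ 2 ->
  (forall n, T n.+1 = fps_divX (T n) + c * T n) ->
  forall n, T n 0%N = f n.+1.
Proof.
move=> Ec Ef T0 TS.
pose V := path_series c.
(* The initial series [(1 + c)^2 = 1 + 2c + c^2] starts paths at heights 0, 1, 2 with weights 1, 2,
   1. *)
have ET n : T n = V n 0%N + 2%:R * V n 1%N + V n 2%N.
  elim: n => [|n IHn]; first by rewrite T0 /V /=; ring.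
  rewrite TS IHn /V !path_series_shift // !fps_divXD !mulr_natl !mulr2n fps_divXD.
  ring.
(* As [c] has constant term 0, taking constant terms keeps only the paths that end at height 0. *)
pose Y k : fps := fun n => V n k 0%N.
have c0 : c 0%N = 0 by rewrite Ec fpsX_mul0.
have Y0 : Y 0%N = 1 + fpsX * Y 1%N.
  apply: fpsP => -[|n]; rewrite fpsD_coef ?fpsX_mul0 ?fpsX_mulS fps1_coef.
    by rewrite addr0 /Y /V /= expr0 fps1_coef.
  by rewrite add0r.
have YS k : Y k.+1 = fpsX * (2%:R * Y k.+2 + 2%:R * Y k.+1 + Y k).
  apply: fpsP => -[|n]; rewrite ?fpsX_mul0 ?fpsX_mulS.
    by rewrite /Y /V /= exprS fpsM_coef0 c0 mul0r.
  by rewrite /Y /V /= !mulr_natl 2!fpsD_coef !fpsMn_coef.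
(* [f] counts first passages from height [k.+1] to height [k]. *)
pose Z k := Y k.+1 - f * Y k.
(* Height 0 has its own step rule, so [Y 1] is expanded by its first step but [f * Y 0] by the
   equation for [f]. *)
have Z0E : Z 0%N = fpsX * (2%:R * Z 1%N + 2%:R * (f * Z 0%N) + 2%:R * Z 0%N).
  rewrite /Z {1}YS {1}Ef; ring.
have ZS k : Z k.+1 = fpsX * (2%:R * Z k.+2 + 2%:R * Z k.+1 + Z k).
  by rewrite /Z {1}(YS k) {1}(YS k.+1); ring.
have Zn := path_relation_trivial Z0E ZS.
have YE k : Y k.+1 = f * Y k.
  by apply/eqP; rewrite -subr_eq0; apply/eqP/fpsP => n; exact: Zn.
have Y01 : Y 0%N - fpsX * f * Y 0%N = 1 by rewrite {1}Y0 YE; ring.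
(* Multiplying [Y01] by [f] and expanding the linear term by the equation for [f] leaves
   [x (1 + 2f + f^2) Y 0]. *)
have -> : f = fpsX * (Y 0%N + 2%:R * Y 1%N + Y 2%N).
  transitivity (f * (Y 0%N - fpsX * f * Y 0%N)); first by rewrite Y01 mulr1.
  by rewrite !YE mulrBr {1}Ef; ring.
move=> n; rewrite fpsX_mulS ET.
by rewrite !mulr_natl !fpsD_coef !fpsMn_coef.
Qed.

(** * Fertility *)

Local Open Scope nat_scope.

Definition preimages (w : seq nat) : seq (seq nat) :=
  [seq v <- permutations w | stack_sort v == w].

Definition fertility (w : seq nat) : nat := size (preimages w).

Lemma mem_preimages (v w : seq nat) : (v \in preimages w) = (stack_sort v == w).
Proof.
rewrite mem_filter mem_permutations; case: eqP => //= <-.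
by rewrite perm_sym perm_stack_sort.
Qed.

Lemma preimages_uniq (w : seq nat) : uniq (preimages w).
Proof. by rewrite filter_uniq ?permutations_uniq. Qed.

(** The preimage is the disjoint union of the fibres, since a word determines its image. *)
Lemma card_stack_preimage (n : nat) (pats : seq (seq nat)) :
  #|` stack_preimage (Av n pats)| =
  \sum_(w <- permutations (iota 1 n) | all (avoids w) pats) fertility w.
Proof.
rewrite -big_filter; set s := filter _ _.
have memA w : (w \in Av n pats) = (w \in s).
  by rewrite /s mem_filter /Av !inE andbC.
transitivity (size [seq v | w <- s, v <- preimages w]); last first.
  by rewrite size_allpairs_dep sumnE big_map.
apply: perm_size; apply: uniq_perm; first exact: fset_uniq.
  apply: allpairs_uniq_dep => [|w _|].
  - by rewrite /s filter_uniq ?permutations_uniq.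
  - exact: preimages_uniq.
  - move=> _ _ /allpairsPdep[w1 [v1 [_ h1 ->]]] /allpairsPdep[w2 [v2 [_ h2 ->]]] /=.
    move=> Ev; move: h1 h2; rewrite !mem_preimages Ev => /eqP <- /eqP <-.
    by [].
move=> v; rewrite [LHS]in_stack_preimage memA; apply/andP/allpairsPdep.
  by move=> [_ vs]; exists (stack_sort v), v; rewrite mem_preimages eqxx.
move=> [w [v' [ws + ->]]]; rewrite mem_preimages => /eqP sv; rewrite sv; split=> //.
have vn : perm_eq v' (iota 1 n).
  move: ws; rewrite /s mem_filter mem_permutations => /andP[_].
  by rewrite -sv; apply: perm_trans; rewrite perm_sym perm_stack_sort.
by rewrite /is_permutation (perm_uniq vn) (perm_mem vn) iota_uniq mem_iota.
Qed.

(** Sorting moves the maximum of [v] to the end, so [m] is that maximum and [L], [R] are the parts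
    of [v] on its two sides. *)
Lemma stack_sort_eq_rcons (v w : seq nat) (m : nat) :
  uniq (rcons w m) -> stack_sort v = rcons w m ->
  exists L R, [/\ v = L ++ m :: R, all (ltn^~ m) L, all (ltn^~ m) R &
                  stack_sort L ++ stack_sort R = w].
Proof.
move=> Uw sv; have := perm_stack_sort v; rewrite sv => pv.
case: v sv pv => [|x v0] sv pv; first by case: (w) sv.
have := mem_bigmax_seq x v0; set M := \max_(_ <- _) _ => Mv.
have leM y : y \in x :: v0 -> y <= M.
  by move=> yv; apply: (leq_bigmax_seq (F := id)).
clearbody M; move: (x :: v0) sv pv Mv leM => {x v0}v sv pv Mv leM.
have Uv : uniq v by rewrite -(perm_uniq pv).
case/splitPr: Mv sv Uv leM {pv} => L R sv Uv leM.
have lt_M y : y \in L ++ R -> y < M.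
  move=> yLR; rewrite ltn_neqAle leM ?andbT; last first.
    by move: yLR; rewrite !mem_cat inE => /orP[->//|->]; rewrite !orbT.
  apply/eqP=> yM; move: Uv yLR; rewrite yM cat_uniq mem_cat /=.
  by case/and3P=> _; rewrite negb_or => /andP[/negbTE-> _] /andP[/negbTE->].
have HL : all (ltn^~ M) L by apply/allP => y yL; rewrite /= lt_M ?mem_cat ?yL.
have HR : all (ltn^~ M) R by apply/allP => y yR; rewrite /= lt_M ?mem_cat ?yR ?orbT.
move: sv; rewrite stack_sort_cat // catA cats1 => /rcons_inj[<- <-].
by exists L, R.
Qed.

Lemma fertility_nil : fertility [::] = 1.
Proof. by []. Qed.

Lemma fertility_rcons (w : seq nat) (m : nat) : uniq (rcons w m) ->
  fertility (rcons w m) = if all (ltn^~ m) w then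
    \sum_(i < (size w).+1) fertility (take i w) * fertility (drop i w) else 0.
Proof.
move=> Uw; case: ifPn => [wm|].
  (* Each preimage is glued from a pair with [m] in between. The position of [m] recovers the pair,
     and the size of [stack_sort L] recovers [i]. *)
  pose pairs i := [seq (L, R) | L <- preimages (take i w), R <- preimages (drop i w)].
  pose glue (_ : nat) (p : seq nat * seq nat) := p.1 ++ m :: p.2.
  transitivity (size [seq glue i p | i <- iota 0 (size w).+1, p <- pairs i]).
    have mempairs i p : p \in pairs i ->
        stack_sort p.1 = take i w /\ stack_sort p.2 = drop i w.
      by case/allpairsP => -[L R] [/= + + ->]; rewrite !mem_preimages => /eqP ? /eqP ?.
    have ltm i p : p \in pairs i -> all (ltn^~ m) p.1 /\ all (ltn^~ m) p.2.
      move=> /mempairs[E1 E2]; rewrite -(perm_all _ (perm_stack_sort p.1)).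
      rewrite -(perm_all _ (perm_stack_sort p.2)) E1 E2.
      by move: wm; rewrite -{1}(cat_take_drop i w) all_cat => /andP.
    apply: perm_size; apply: uniq_perm; first exact: preimages_uniq.
      apply: allpairs_uniq_dep => [|i _|].
      - exact: iota_uniq.
      - apply: allpairs_uniq; try exact: preimages_uniq.
        by move=> [? ?] [? ?] _ _ [-> ->].
      - move=> _ _ /allpairsPdep[i1 [[L1 R1] [i1w h1 ->]]]
          /allpairsPdep[i2 [[L2 R2] [i2w h2 ->]]] /= Eg.
        have [lt1 _] := ltm _ _ h1; have [lt2 _] := ltm _ _ h2.
        have nm L : all (ltn^~ m) L -> m \notin L.
          by move=> h; apply/negP => /(allP h); rewrite /= ltnn.
        have EL : L1 = L2.
          have EE L R : all (ltn^~ m) L -> take (index m (L ++ m :: R)) (L ++ m :: R) = L.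
            by move=> h; rewrite index_cat (negbTE (nm _ h)) /= eqxx addn0 take_size_cat.
          by have := congr1 (fun v => take (index m v) v) Eg; rewrite /glue /= !EE.
        have ER : R1 = R2.
          move: Eg; rewrite /glue /= EL => /eqP; rewrite eqseq_cat // eqxx /=.
          by rewrite eqseq_cons eqxx /= => /eqP.
        have Ei : i1 = i2.
          have [E1 _] := mempairs _ _ h1; have [E2 _] := mempairs _ _ h2.
          move: i1w i2w; rewrite !mem_iota !add0n /= !ltnS => i1w i2w.
          move: (congr1 size E1) (congr1 size E2); rewrite /= EL => ->.
          by rewrite !size_takel.
        by rewrite EL ER Ei.
    move=> v; rewrite mem_preimages; apply/eqP/allpairsPdep.
      case/(stack_sort_eq_rcons Uw) => L [R [-> _ _ Ew]].
      exists (size (stack_sort L)), (L, R); split=> //.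
        by rewrite mem_iota /= add0n -Ew size_cat ltnS leq_addr.
      apply/allpairsP; exists (L, R); split=> //=.
        by rewrite mem_preimages -Ew take_size_cat.
      by rewrite mem_preimages -Ew drop_size_cat.
    move=> [i [p [_ hp ->]]]; have [E1 E2] := mempairs _ _ hp.
    have [l1 l2] := ltm _ _ hp.
    by rewrite /glue stack_sort_cat // E1 E2 catA cat_take_drop cats1.
  rewrite size_allpairs_dep sumnE big_map -[X in iota 0 X]subn0.
  rewrite -/(index_iota 0 (size w).+1) big_mkord.
  by apply: eq_bigr => i _; rewrite size_allpairs.
move=> nm; apply/eqP; rewrite size_eq0; apply/eqP.
case E: (preimages _) => [//|v s].
have : v \in preimages (rcons w m) by rewrite E mem_head.
rewrite mem_preimages => /eqP /(stack_sort_eq_rcons Uw) [L [R [_ lL lR Ew]]].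
case/negP: nm; rewrite -Ew all_cat !(perm_all _ (perm_stack_sort _)).
by rewrite lL lR.
Qed.

Lemma uniq_take_drop (T : eqType) (w : seq T) i :
  uniq w -> uniq (take i w) /\ uniq (drop i w).
Proof. by rewrite -{1}(cat_take_drop i w) cat_uniq => /and3P[]. Qed.

(** The recursion [fertility_rcons] uses only comparisons of entries, which [f] preserves. *)
Lemma fertility_map (f : nat -> nat) (w : seq nat) :
  {mono f : x y / x < y} -> uniq w -> fertility (map f w) = fertility w.
Proof.
move=> mf; have injf : injective f.
  by move=> x y Exy; case: (ltngtP x y) => //; rewrite -mf Exy ltnn.
have [n] := ubnP (size w); elim: n w => // n IHn w; case/lastP: w => [//|w m].
rewrite size_rcons ltnS => wn Uw.
rewrite map_rcons !fertility_rcons -?map_rcons ?map_inj_uniq //.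
rewrite all_map size_map (@eq_all _ _ (ltn^~ m)); last by move=> x; rewrite /= mf.
case: ifP => // _; apply: eq_bigr => i _; rewrite -map_take -map_drop.
have [Ut Ud] : uniq (take i w) /\ uniq (drop i w).
  by apply: uniq_take_drop; move: Uw; rewrite rcons_uniq => /andP[].
rewrite !IHn ?size_take ?size_drop //.
- by apply: leq_ltn_trans wn; rewrite leq_subr.
- by apply: leq_ltn_trans wn; case: ifP => // /ltnW.
Qed.

(** * Pattern avoidance *)

Definition avoids3 (P : nat -> nat -> nat -> bool) (w : seq nat) : Prop :=
  forall a b c, subseq [:: a; b; c] w -> ~~ P a b c.

Lemma avoids3P (P : nat -> nat -> nat -> bool) (t w : seq nat) :
  size t = 3 -> (forall a b c, (normalization [:: a; b; c] == t) = P a b c) ->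
  avoids w t <-> avoids3 P w.
Proof.
move=> t3 HP; rewrite /avoids /contains; split.
  move/existsPn => H a b c /subseqP[m sm Em]; rewrite -HP Em.
  by move/eqP: sm => sm; exact: (H (Tuple sm)).
move=> H; apply/existsPn => m; apply/negP => /eqP Em.
have: size (mask m w) = 3 by rewrite -t3 -Em size_map.
have: subseq (mask m w) w by apply: mask_subseq.
case: (mask m w) Em => [|a [|b [|c []]]] // Em /H + _.
by rewrite -HP Em eqxx.
Qed.

Lemma index_sorted (x : nat) (s : seq nat) :
  sorted leq s -> x \in s -> index x s = count (ltn^~ x) s.
Proof.
elim: s => //= y s IHs sy; have /allP ley := order_path_min leq_trans sy.
rewrite inE (eq_sym y); case: eqP => [-> _|/eqP xy /= xs].
  rewrite ltnn add0n; apply/esym/eqP; rewrite eqn0Ngt -has_count.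
  by apply/hasPn => z /ley; rewrite -leqNgt.
by rewrite ltn_neqAle eq_sym xy ley // add1n IHs // (path_sorted sy).
Qed.

(** Ranks as counts reduce the three-letter patterns to linear arithmetic. Repeated entries are
    allowed, as [index] finds the first occurrence. *)
Lemma normalization_count (w : seq nat) :
  normalization w = [seq (count (ltn^~ x) w).+1 | x <- w].
Proof.
apply/eq_in_map => x xw; rewrite index_sorted ?mem_sort ?sort_sorted //.
  by rewrite (permP (permEl (perm_sort _ _))).
Qed.

Lemma normalization132 a b c :
  (normalization [:: a; b; c] == [:: 1; 3; 2]) = (a < c < b).
Proof.
by rewrite normalization_count /= !eqseq_cons eqxx andbT !ltnn; lia.
Qed.

Lemma normalization231 a b c :
  (normalization [:: a; b; c] == [:: 2; 3; 1]) = (c < a < b).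
Proof.
by rewrite normalization_count /= !eqseq_cons eqxx andbT !ltnn; lia.
Qed.

Lemma normalization312 a b c :
  (normalization [:: a; b; c] == [:: 3; 1; 2]) = (b < c < a).
Proof.
by rewrite normalization_count /= !eqseq_cons eqxx andbT !ltnn; lia.
Qed.

Lemma subseq_rcons2 (T : eqType) (s w : seq T) (c x : T) :
  subseq (rcons s c) (rcons w x) =
  if c == x then subseq s w else subseq (rcons s c) w.
Proof.
(* Reversal turns last letters into heads, where [subseq] computes. *)
rewrite -subseq_rev !rev_rcons /= eq_sym; case: eqP => _.
  exact: subseq_rev.
by rewrite -rev_rcons subseq_rev.
Qed.

Lemma subseq_pair (T : eqType) (w : seq T) (a b : T) :
  a \in w -> b \in w -> a != b -> subseq [:: a; b] w || subseq [:: b; a] w.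
Proof.
elim/last_ind: w => // w x IHw; rewrite !mem_rcons !inE => aw bw ab.
rewrite -[[:: a; b]]/(rcons [:: a] b) -[[:: b; a]]/(rcons [:: b] a) !subseq_rcons2.
rewrite !sub1seq /=; case: (eqVneq b x) aw bw => [<-|_] /=; first by rewrite (negbTE ab) /= => ->.
by case: (eqVneq a x) => /= [_ _ ->|_ aw bw]; [rewrite orbT|exact: IHw].
Qed.

Lemma avoids3_subseq P (v w : seq nat) :
  subseq v w -> avoids3 P w -> avoids3 P v.
Proof. by move=> vw Hw a b c abc; apply: Hw; apply: subseq_trans vw. Qed.

Lemma avoids3_map P (f : nat -> nat) (w : seq nat) :
  (forall a b c, P (f a) (f b) (f c) = P a b c) ->
  avoids3 P (map f w) <-> avoids3 P w.
Proof.
move=> Pf; split=> H a b c abc.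
  by rewrite -Pf; apply: H; exact: (map_subseq f abc).
have /subseqP[m _] := abc; rewrite -map_mask.
case Em: (mask m w) => [|a' [|b' [|c' []]]] //= [-> -> ->].
by rewrite Pf; apply: H; rewrite -Em mask_subseq.
Qed.

Lemma avoids3_rcons P (w : seq nat) (x : nat) :
  avoids3 P (rcons w x) <->
  avoids3 P w /\ forall a b, subseq [:: a; b] w -> ~~ P a b x.
Proof.
split=> [H|[H1 H2] a b c].
  split=> [|a b ab]; first exact: avoids3_subseq (subseq_rcons w x) H.
  apply: H; rewrite -[[:: a; b; x]]/(rcons [:: a; b] x) subseq_rcons2 eqxx.
  by [].
rewrite -[[:: a; b; c]]/(rcons [:: a; b] c) subseq_rcons2.
by case: eqP => [->|_]; [exact: H2|exact: H1].
Qed.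

(** * Ascent words *)

Definition asc (w : seq nat) : seq bool :=
  if w is x :: w' then pairmap ltn x w' else [::].

Lemma size_asc (w : seq nat) : size (asc w) = (size w).-1.
Proof. by case: w => //= x w; rewrite size_pairmap. Qed.

Lemma asc_rcons2 (w : seq nat) (y x : nat) :
  asc (rcons (rcons w y) x) = rcons (asc (rcons w y)) (y < x).
Proof.
case: w => //= z w; rewrite -[rcons (rcons w y) x]cats1 pairmap_cat last_rcons.
by rewrite /= cats1.
Qed.

Lemma asc_take (w : seq nat) i : asc (take i.+1 w) = take i (asc w).
Proof.
case: w => //= x w; elim: w i x => [|y w IHw] [|i] x //=; by rewrite IHw.
Qed.

Lemma asc_drop (w : seq nat) i : asc (drop i w) = drop i (asc w).
Proof.
elim: i w => [|i IHi] w; first by rewrite !drop0.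
by case: w => [|x [|y w]] //=; rewrite -[RHS]IHi.
Qed.

Lemma asc_map (f : nat -> nat) (w : seq nat) :
  {mono f : x y / x < y} -> asc (map f w) = asc w.
Proof.
move=> mf; case: w => //= x w.
by elim: w x => //= y w IHw x; rewrite IHw mf.
Qed.

Definition pat132 (a b c : nat) := a < c < b.
Definition pat231 (a b c : nat) := c < a < b.
Definition pat312 (a b c : nat) := b < c < a.

(* A larger entry in front of a final ascent would create a 312. *)
Lemma max_last_asc (w : seq nat) (x : nat) :
  uniq (rcons w x) -> avoids3 pat312 (rcons w x) ->
  all (ltn^~ x) w = last true (asc (rcons w x)).
Proof.
(* For empty [w] the default [true] of [last] is right: a single entry is its own maximum. *)
case/lastP: w => // w y Uw Aw; rewrite asc_rcons2 last_rcons all_rcons /=.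
case: ltnP => //= yx; apply/allP => c cw /=; rewrite ltnNge leq_eqVlt negb_or.
apply/andP; split.
  apply: contraL Uw => /eqP xc; rewrite rcons_uniq xc mem_rcons inE cw orbT.
  by [].
apply/negP => xc; have := Aw c y x; rewrite /pat312 yx xc => /(_ _)/negP; apply=> //.
rewrite -[[:: c; y; x]]/(rcons (rcons [:: c] y) x) !subseq_rcons2 !eqxx.
by rewrite sub1seq.
Qed.

(** Induction along [fertility_rcons]: the last ascent bit decides whether the last entry is the
    maximum, and factors of the word correspond to factors of its ascent word. Sizes are compared
    separately because empty and one-letter words share the empty ascent word. *)
Lemma fertility_asc (v w : seq nat) :
  uniq v -> uniq w -> avoids3 pat312 v -> avoids3 pat312 w ->
  size v = size w -> asc v = asc w -> fertility v = fertility w.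
Proof.
have [n] := ubnP (size v); elim: n v w => // n IHn v w.
case/lastP: v => [|v x]; case/lastP: w => [|w y] //; rewrite ?size_rcons //.
rewrite ltnS => vn Uv Uw Av Aw [svw] Avw.
rewrite !fertility_rcons // !max_last_asc // Avw svw.
case: ifP => // _; apply: eq_bigr => i _.
have Evw : asc v = asc w.
  have E u z : asc u = take (size u).-1 (asc (rcons u z)).
    case/lastP: u => // u t; rewrite asc_rcons2 size_rcons /=.
    by rewrite -[rcons (asc _) _]cats1 take_size_cat // size_asc size_rcons.
  by rewrite (E v x) (E w y) svw Avw.
have [Utv Udv] : uniq (take i v) /\ uniq (drop i v).
  by apply: uniq_take_drop; move: Uv; rewrite rcons_uniq => /andP[].
have [Utw Udw] : uniq (take i w) /\ uniq (drop i w).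
  by apply: uniq_take_drop; move: Uw; rewrite rcons_uniq => /andP[].
have A' u z s : avoids3 pat312 (rcons u z) -> subseq s u -> avoids3 pat312 s.
  by move=> H su; apply: avoids3_subseq H; apply: subseq_trans su (subseq_rcons _ _).
have [tv dv] := (take_subseq v i, drop_subseq v i).
have [tw dw] := (take_subseq w i, drop_subseq w i).
congr (_ * _); apply: IHn => //.
- by apply: leq_ltn_trans vn; rewrite size_take_min geq_minr.
- exact: A' Av tv.
- exact: A' Aw tw.
- by rewrite !size_take_min svw.
- by case: (i : nat) => [|j]; rewrite ?take0 // !asc_take Evw.
- by apply: leq_ltn_trans vn; rewrite size_drop leq_subr.
- exact: A' Av dv.
- exact: A' Aw dw.
- by rewrite !size_drop svw.
- by rewrite !asc_drop Evw.
Qed.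

(** * Building permutations by appending a last entry *)

Fixpoint bits (n : nat) : seq (seq bool) :=
  if n is m.+1 then
    [seq rcons b true | b <- bits m] ++ [seq rcons b false | b <- bits m]
  else [:: [::]].

Lemma sum_bitsS n (G : seq bool -> nat) :
  \sum_(b <- bits n.+1) G b =
  \sum_(b <- bits n) (G (rcons b true) + G (rcons b false)).
Proof. by rewrite big_cat !big_map big_split. Qed.

Lemma size_bits n b : b \in bits n -> size b = n.
Proof.
elim: n b => [|n IHn] b /=; first by rewrite inE => /eqP->.
by rewrite mem_cat => /orP[] /mapP[c /IHn <- ->]; rewrite size_rcons.
Qed.

Lemma sum_bits_cat i j (G : seq bool -> nat) :
  \sum_(b <- bits (i + j)) G b =
  \sum_(b <- bits i) \sum_(c <- bits j) G (b ++ c).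
Proof.
elim: j G => [|j IHj] G.
  by rewrite addn0; apply: eq_bigr => b _; rewrite big_seq1 cats0.
rewrite addnS sum_bitsS IHj; apply: eq_bigr => b _; rewrite sum_bitsS.
by apply: eq_bigr => c _; rewrite !rcons_cat.
Qed.

(** [bump x] raises the entries that are at least [x], which frees the value [x] and keeps the
    relative order. *)
Definition insert_last (w : seq nat) (x : nat) := rcons (map (bump x) w) x.

Lemma bump_mono x : {mono bump x : a b / a < b}.
Proof. by move=> a b; rewrite /bump; lia. Qed.

Lemma mem_permutations_iota n (w : seq nat) :
  (w \in permutations (iota 1 n)) =
  [&& uniq w, size w == n & all (fun x => 0 < x <= n) w].
Proof.
have E x : (x \in iota 1 n) = (0 < x <= n) by rewrite mem_iota; lia.
rewrite mem_permutations; apply/idP/and3P => [wn|[Uw /eqP sw /allP aw]].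
  rewrite (perm_uniq wn) iota_uniq (perm_size wn) size_iota eqxx; split=> //.
  by apply/allP => x; rewrite (perm_mem wn) E.
have sub : {subset w <= iota 1 n} by move=> x /aw; rewrite E.
apply: uniq_perm; rewrite ?iota_uniq //.
by have [] := uniq_min_size Uw sub; rewrite ?size_iota ?sw.
Qed.

Lemma mem_insert_last n (w : seq nat) (x : nat) : x \in iota 1 n.+1 ->
  (insert_last w x \in permutations (iota 1 n.+1)) =
  (w \in permutations (iota 1 n)).
Proof.
rewrite mem_iota !mem_permutations_iota => xn.
rewrite /insert_last rcons_uniq size_rcons size_map all_rcons all_map.
rewrite (map_inj_uniq (can_inj (bumpK x))) eqSS.
have -> : x \notin [seq bump x i | i <- w].
  by apply/mapP => -[y _ /eqP]; rewrite (negbTE (neq_bump _ _)).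
case: (uniq w) => //=; case: eqP => //= sw; rewrite -[RHS]andTb; congr (_ && _).
  by lia.
by apply: eq_all => y /=; rewrite /bump; lia.
Qed.

Lemma insert_last_inj w1 x1 w2 x2 :
  insert_last w1 x1 = insert_last w2 x2 -> w1 = w2 /\ x1 = x2.
Proof.
by move=> /rcons_inj[+ Ex]; rewrite Ex => /(inj_map (can_inj (bumpK x2))).
Qed.

(** Deleting the last entry [x] and closing the gap with [unbump x] inverts the insertion. *)
Lemma sum_insert_last n (H : seq nat -> nat) :
  \sum_(w <- permutations (iota 1 n.+1)) H w =
  \sum_(w <- permutations (iota 1 n)) \sum_(x <- iota 1 n.+1) H (insert_last w x).
Proof.
rewrite -(big_allpairs (F := fun p => H (insert_last p.1 p.2))).
rewrite -(big_map (fun p => insert_last p.1 p.2) xpredT).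
apply/perm_big/uniq_perm; first exact: permutations_uniq.
  rewrite map_inj_uniq; last by move=> [? ?] [? ?] /= /insert_last_inj[-> ->].
  apply: allpairs_uniq; rewrite ?permutations_uniq ?iota_uniq //.
  by move=> [? ?] [? ?] _ _ [-> ->].
move=> w; apply/idP/mapP; last first.
  by move=> [_ /allpairsP[[v x] /= [vn xn ->]] ->] /=; rewrite mem_insert_last.
case/lastP: w => [|w x]; first by rewrite mem_permutations_iota.
move=> wn; exists (map (unbump x) w, x).
  have := wn; rewrite mem_permutations_iota all_rcons => /and3P[Uw _ /andP[xn _]].
  have xn' : x \in iota 1 n.+1 by rewrite mem_iota; lia.
  apply/allpairsP; exists (map (unbump x) w, x); split=> //=.
  rewrite -(mem_insert_last _ xn') /insert_last -map_comp map_id_in //.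
  move=> y yw /=; rewrite unbumpK // inE; apply: contraL Uw => /eqP <-.
  by rewrite rcons_uniq yw.
have := wn; rewrite mem_permutations_iota => /and3P[Uw _ _].
rewrite /insert_last -map_comp map_id_in // => y yw /=; rewrite unbumpK // inE.
by apply: contraL Uw => /eqP <-; rewrite rcons_uniq yw.
Qed.

Lemma asc_insert_last (w : seq nat) (x : nat) :
  0 < size w -> asc (insert_last w x) = rcons (asc w) (last 0 w < x).
Proof.
case/lastP: w => // w y _; rewrite /insert_last map_rcons asc_rcons2 -map_rcons.
rewrite (asc_map _ (@bump_mono x)) last_rcons; congr rcons.
by rewrite /bump; lia.
Qed.

(** A word of the class extends in exactly two ways: by the new maximum, an ascent, or by [o w], a
    descent because [o w <= last 0 w]. Hence each ascent word occurs once. *)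
Lemma sum_asc (Q : seq nat -> bool) (o : seq nat -> nat) (G : seq bool -> nat) :
  Q [:: 1] ->
  (forall n w, 0 < n -> w \in permutations (iota 1 n) ->
    0 < o w <= last 0 w /\
    forall x, x \in iota 1 n.+1 ->
      Q (insert_last w x) = Q w && ((x == n.+1) || (x == o w))) ->
  forall n, \sum_(w <- permutations (iota 1 n.+1) | Q w) G (asc w) =
    \sum_(b <- bits n) G b.
Proof.
move=> Q1 Qo n; elim: n G => [|n IHn] G.
  by rewrite big_mkcond /= !big_seq1 Q1.
rewrite big_mkcond sum_insert_last sum_bitsS -IHn [RHS]big_mkcond.
apply: eq_big_seq => w wn; have [ow Qw] := Qo _ _ (ltn0Sn n) wn.
have [sw lw] : 0 < size w /\ last 0 w <= n.+1.
  move: wn; rewrite mem_permutations_iota => /and3P[_ /eqP sw /allP aw].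
  rewrite sw; split=> //; suff /aw : last 0 w \in w by lia.
  by case: (w) sw => //= y u _; rewrite mem_last.
(* The top value [n.+2] is split off as the ascent; among the smaller values only [o w] survives. *)
rewrite -[iota _ _]/(index_iota 1 n.+3) big_nat_recr //=.
rewrite Qw ?mem_iota ?eqxx ?andbT; last by lia.
rewrite asc_insert_last // (_ : last 0 w < n.+2); last by lia.
rewrite addnC; case Ew: (Q w); last first.
  rewrite big_nat big1 ?addn0 // => x xn.
  by rewrite Qw ?Ew // mem_iota; lia.
congr (_ + _).
transitivity (\sum_(1 <= x < n.+2 | x == o w) G (asc (insert_last w x))).
  rewrite [RHS]big_mkcond; apply: eq_big_nat => x xn.
  rewrite Qw ?Ew ?mem_iota /=; last by lia.
  by rewrite (_ : (x == n.+2) = false); last by lia.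
rewrite (big_nat1_eq _ (fun x => G (asc (insert_last w x)))) ifT; last by lia.
by rewrite asc_insert_last // ltnNge (_ : o w <= last 0 w); last by lia.
Qed.

(** * Admissible last entries in the classes avoiding 312 *)

Lemma avoids132_312 (w : seq nat) :
  all (avoids w) [:: [:: 1; 3; 2]; [:: 3; 1; 2]] <->
  avoids3 pat132 w /\ avoids3 pat312 w.
Proof.
rewrite -(avoids3P w _ normalization132) // -(avoids3P w _ normalization312) //.
by rewrite /= andbT; split=> /andP.
Qed.

Lemma avoids231_312 (w : seq nat) :
  all (avoids w) [:: [:: 2; 3; 1]; [:: 3; 1; 2]] <->
  avoids3 pat231 w /\ avoids3 pat312 w.
Proof.
rewrite -(avoids3P w _ normalization231) // -(avoids3P w _ normalization312) //.
by rewrite /= andbT; split=> /andP.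
Qed.

Lemma avoids132_231 (w : seq nat) :
  all (avoids w) [:: [:: 1; 3; 2]; [:: 2; 3; 1]] <->
  avoids3 pat132 w /\ avoids3 pat231 w.
Proof.
rewrite -(avoids3P w _ normalization132) // -(avoids3P w _ normalization231) //.
by rewrite /= andbT; split=> /andP.
Qed.

Lemma avoids3_insert_last P (w : seq nat) (x : nat) :
  (forall a b c, P (bump x a) (bump x b) (bump x c) = P a b c) ->
  avoids3 P (insert_last w x) <-> avoids3 P w /\
    forall a b, subseq [:: a; b] w -> ~~ P (bump x a) (bump x b) x.
Proof.
move=> Px; rewrite /insert_last avoids3_rcons (avoids3_map _ Px).
split=> -[H1 H2]; split=> // a b ab.
  exact: H2 (map_subseq (bump x) ab).
have /subseqP[m _] := ab; rewrite -map_mask.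
case Em: (mask m w) => [|a' [|b' []]] //= [-> ->]; apply: H2.
by rewrite -Em mask_subseq.
Qed.

Lemma pat_bump x : [/\
  forall a b c, pat132 (bump x a) (bump x b) (bump x c) = pat132 a b c,
  forall a b c, pat231 (bump x a) (bump x b) (bump x c) = pat231 a b c &
  forall a b c, pat312 (bump x a) (bump x b) (bump x c) = pat312 a b c].
Proof.
by split=> a b c; rewrite /pat132 /pat231 /pat312 !bump_mono.
Qed.

Lemma mem_perm_iota n (w : seq nat) : w \in permutations (iota 1 n) ->
  [/\ uniq w, size w = n & forall x, (x \in w) = (0 < x <= n)].
Proof.
rewrite mem_permutations => wn; rewrite (perm_uniq wn) iota_uniq.
rewrite (perm_size wn) size_iota; split=> // x.
by rewrite (perm_mem wn) mem_iota; lia.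
Qed.

Lemma last_mem (T : eqType) (x : T) (w : seq T) : 0 < size w -> last x w \in w.
Proof. by case: w => // y w _; rewrite /= mem_last. Qed.

Lemma mem_subseq2 (w : seq nat) a b : subseq [:: a; b] w -> a \in w /\ b \in w.
Proof.
by move/mem_subseq => H; split; apply: H; rewrite !inE eqxx ?orbT.
Qed.

(** If [1 < x <= n], the entries [x.-1] and [x] of [w] become [x.-1] and [x.+1]; followed by [x]
    they form 132 or 312, depending on their order. An extremal [x] cannot be the middle value,
    which ends both patterns. *)
Lemma insert_last_132_312 n w : 0 < n -> w \in permutations (iota 1 n) ->
  0 < 1 <= last 0 w /\ forall x, x \in iota 1 n.+1 ->
    all (avoids (insert_last w x)) [:: [:: 1; 3; 2]; [:: 3; 1; 2]] =
    all (avoids w) [:: [:: 1; 3; 2]; [:: 3; 1; 2]] && ((x == n.+1) || (x == 1)).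
Proof.
move=> n0 wn; have [Uw sw mw] := mem_perm_iota wn; split.
  by have := last_mem 0 (w := w); rewrite sw mw => /(_ n0) /andP[].
move=> x; rewrite mem_iota => xn; have [b1 _ b3] := pat_bump x.
apply/idP/andP => [/avoids132_312|[/avoids132_312[A1 A2] xo]].
  rewrite !avoids3_insert_last // => -[[A1 B1] [A2 B2]].
  split; first exact/avoids132_312.
  case: (boolP (_ || _)) => // xo.
  have m1 : x.-1 \in w by rewrite mw; lia.
  have m2 : x \in w by rewrite mw; lia.
  have := subseq_pair m1 m2; case/(_ _)/orP => [|/B1|/B2]; first by lia.
    by rewrite /pat132 /bump; lia.
  by rewrite /pat312 /bump; lia.
apply/avoids132_312; rewrite !avoids3_insert_last //.
split; split=> // a b /mem_subseq2[]; rewrite !mw /pat132 /pat312 /bump; lia.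
Qed.

(** If [x <= n] differs from the last entry [y], the old [x] becomes [x.+1], and [x.+1], the bumped
    [y], [x] form 231 or 312. If [x = y], a pattern ending in [x] would already occur in [w] ending
    in [y]. *)
Lemma insert_last_231_312 n w : 0 < n -> w \in permutations (iota 1 n) ->
  0 < last 0 w <= last 0 w /\ forall x, x \in iota 1 n.+1 ->
    all (avoids (insert_last w x)) [:: [:: 2; 3; 1]; [:: 3; 1; 2]] =
    all (avoids w) [:: [:: 2; 3; 1]; [:: 3; 1; 2]]
      && ((x == n.+1) || (x == last 0 w)).
Proof.
move=> n0 wn; have [Uw sw mw] := mem_perm_iota wn.
case/lastP: w wn Uw sw mw => [|w y] wn Uw sw mw; first by move: n0; rewrite -sw.
rewrite last_rcons leqnn andbT.
have yn : 0 < y <= n by rewrite -mw mem_rcons mem_head.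
split=> [|x]; first by lia.
have Ny : y \notin w by move: Uw; rewrite rcons_uniq => /andP[].
rewrite mem_iota => xn; have [_ b2 b3] := pat_bump x.
apply/idP/andP => [/avoids231_312|[/avoids231_312[A1 A2] xo]].
  rewrite !avoids3_insert_last // => -[[A1 B1] [A2 B2]].
  split; first exact/avoids231_312.
  case: (boolP (_ || _)) => // xo.
  have m1 : x \in w.
    have : x \in rcons w y by rewrite mw; lia.
    by rewrite mem_rcons inE; move: xo; case: (x =P y) => //; lia.
  have xy : subseq [:: x; y] (rcons w y).
    by rewrite -[[:: x; y]]/(rcons [:: x] y) subseq_rcons2 eqxx sub1seq.
  by have := B1 _ _ xy; have := B2 _ _ xy; rewrite /pat231 /pat312 /bump; lia.
apply/avoids231_312; rewrite !avoids3_insert_last //.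
have xy a b : subseq [:: a; b] (rcons w y) -> b != y ->
  a \in w /\ subseq [:: a; b; y] (rcons w y).
  rewrite -[[:: a; b; y]]/(rcons [:: a; b] y) -[[:: a; b]]/(rcons [:: a] b).
  rewrite !subseq_rcons2 eqxx => + by_; rewrite (negbTE by_) => ab.
  by split=> //; have [] := mem_subseq2 ab.
have Ey a : a \in w -> a != y by apply: contraTneq => ->.
split; split=> // a b ab; have [] := mem_subseq2 ab; rewrite !mw => an bn.
  case: (eqVneq b y) => [|/(xy _ _ ab)[/Ey ay /A1]].
    by rewrite /pat231 /bump; lia.
  by rewrite /pat231 /bump; lia.
case: (eqVneq b y) => [|/(xy _ _ ab)[/Ey ay /A2]].
  by rewrite /pat312 /bump; lia.
by rewrite /pat312 /bump; lia.
Qed.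

(** * Fertility as a function of the ascent word *)

Lemma avoids3_short P (w : seq nat) : size w < 3 -> avoids3 P w.
Proof. by move=> w3 a b c /size_subseq; rewrite leqNgt w3. Qed.

(** The newest bit is the head. The word of [b'] has [(size b').+1] letters, so [(size b').+2] is a
    new maximum and 1 a new minimum. *)
Fixpoint rev_asc_word (b : seq bool) : seq nat :=
  if b is x :: b' then
    insert_last (rev_asc_word b') (if x then (size b').+2 else 1)
  else [:: 1].

(* The permutation in [Av(132, 312)] with ascent word [b]. *)
Definition asc_word (b : seq bool) : seq nat := rev_asc_word (rev b).

Lemma asc_word_rcons b x :
  asc_word (rcons b x) = insert_last (asc_word b) (if x then (size b).+2 else 1).
Proof. by rewrite /asc_word rev_rcons /= size_rev. Qed.

Lemma asc_wordP b : [/\ asc_word b \in permutations (iota 1 (size b).+1),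
  avoids3 pat312 (asc_word b) & asc (asc_word b) = b].
Proof.
suff [H1 H2 H3] : [/\ asc_word b \in permutations (iota 1 (size b).+1),
    all (avoids (asc_word b)) [:: [:: 1; 3; 2]; [:: 3; 1; 2]] &
    asc (asc_word b) = b].
  by split=> //; have [/avoids132_312[]] := (conj H2 H2).
elim/last_ind: b => [|b x [H1 H2 H3]].
  by split=> //; apply/avoids132_312; split; apply: avoids3_short.
rewrite asc_word_rcons size_rcons.
have xn : (if x then (size b).+2 else 1) \in iota 1 (size b).+2.
  by rewrite mem_iota; case: x; lia.
have [o1 o2] := insert_last_132_312 (ltn0Sn _) H1.
rewrite mem_insert_last // o2 // H1 H2; split=> //.
  by case: (x); rewrite eqxx ?orbT.
have [Uw sw mw] := mem_perm_iota H1.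
rewrite asc_insert_last ?sw // H3; congr rcons.
have := last_mem 0 (w := asc_word b).
rewrite sw mw => /(_ isT)/andP[l0 ln].
by case: (x); [rewrite ltnS ln|rewrite ltnNge l0].
Qed.

(** By [fertility_asc], any other word avoiding 312 with ascent word [b] and [(size b).+1] distinct
    letters gives the same value. *)
Definition asc_fertility (b : seq bool) : nat := fertility (asc_word b).

Lemma asc_fertilityE (w : seq nat) : 0 < size w -> uniq w ->
  avoids3 pat312 w -> fertility w = asc_fertility (asc w).
Proof.
move=> sw Uw Aw; have [wb Ab Eb] := asc_wordP (asc w).
have [Ub sb _] := mem_perm_iota wb.
by apply: fertility_asc; rewrite // sb size_asc prednK.
Qed.

(** The two factorisations with an empty factor give [2 * asc_fertility b]; a cut between two
    letters deletes the bit [i] that compares them. *)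
Lemma asc_fertility_rcons (b : seq bool) (x : bool) :
  asc_fertility (rcons b x) = if x then
    2 * asc_fertility b +
      \sum_(i < size b) asc_fertility (take i b) * asc_fertility (drop i.+1 b)
  else 0.
Proof.
have [wb Ab Eb] := asc_wordP (rcons b x).
rewrite /asc_fertility; move: wb Ab Eb; case/lastP: (asc_word _) => [|w m].
  by rewrite mem_permutations_iota.
move=> wb; have [Ub + _] := mem_perm_iota wb; rewrite !size_rcons => -[sw] Ab Eb.
rewrite fertility_rcons // max_last_asc // Eb last_rcons; case: (x) => //.
have Ew : asc w = b.
  case/lastP: w sw Eb {wb Ab Ub} => // w y _.
  by rewrite asc_rcons2 => /rcons_inj[].
have [Uw Aw] : uniq w /\ avoids3 pat312 w.
  split; first by move: Ub; rewrite rcons_uniq => /andP[].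
  exact: avoids3_subseq (subseq_rcons _ _) Ab.
rewrite sw big_ord_recl big_ord_recr /= !take0 !drop0 /bump !add1n.
rewrite take_oversize ?sw // drop_oversize ?sw // fertility_nil mul1n muln1.
have -> : fertility w = asc_fertility b by rewrite asc_fertilityE ?sw ?Ew.
rewrite addnCA addnn -mul2n addnC; congr (_ + _).
apply: eq_bigr => i _; have := ltn_ord i => lt_i.
have [Ut Ud] := uniq_take_drop i.+1 Uw.
have [st sd] : 0 < size (take i.+1 w) /\ 0 < size (drop i.+1 w).
  by rewrite size_take_min size_drop sw; lia.
have At := avoids3_subseq (take_subseq w i.+1) Aw.
have Ad := avoids3_subseq (drop_subseq w i.+1) Aw.
rewrite (asc_fertilityE st) // asc_take Ew.
by rewrite (asc_fertilityE sd) // asc_drop Ew.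
Qed.

Definition asc_total (n : nat) : nat := \sum_(b <- bits n) asc_fertility b.

Lemma asc_total0 : asc_total 0 = 1.
Proof.
rewrite /asc_total big_seq1 /asc_fertility /asc_word /=.
rewrite -[[:: 1]]/(rcons [::] 1) fertility_rcons // big_ord1.
by rewrite fertility_nil.
Qed.

(** Only words ending in an ascent contribute. The factor 2 before the convolution counts the two
    values of the bit deleted by the cut. *)
Lemma asc_totalS n : asc_total n.+1 =
  2 * asc_total n + 2 * \sum_(i < n) asc_total i * asc_total (n - i.+1).
Proof.
rewrite /asc_total sum_bitsS.
transitivity (\sum_(b <- bits n) (2 * asc_fertility b + \sum_(i < n)
   asc_fertility (take i b) * asc_fertility (drop i.+1 b))).
  apply: eq_big_seq => b /size_bits <-.
  by rewrite !asc_fertility_rcons addn0.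
rewrite big_split -big_distrr /= exchange_big; congr (_ + _); rewrite big_distrr /=.
apply: eq_bigr => i _; have := ltn_ord i => lt_in.
have {1}-> : n = i.+1 + (n - i.+1) by lia.
rewrite sum_bits_cat sum_bitsS big_distrlr /= big_distrr /=.
apply: eq_big_seq => b /size_bits sb; rewrite big_distrr -big_split /=.
apply: eq_bigr => c _; rewrite !cat_rcons !take_size_cat //.
rewrite -!cat_rcons !drop_size_cat ?size_rcons ?sb //; lia.
Qed.

Local Open Scope ring_scope.

(** The index shifts because a word of [m.+1] letters has [m] ascent bits. *)
Definition asc_series : fps := fun n => if n is m.+1 then (asc_total m)%:R else 0.

Lemma asc_series_eq :
  asc_series = fpsX * (1 + 2%:R * asc_series + 2%:R * asc_series ^+ 2).
Proof.
apply: fpsP => -[|n]; rewrite ?fpsX_mul0 // fpsX_mulS !mulr_natl !fpsD_coef.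
rewrite !fpsMn_coef fps1_coef expr2 fpsM_coef.
case: n => [|n].
  by rewrite big_ord1 /= mul0r !mul0rn !addr0 asc_total0.
rewrite add0r /= asc_totalS big_ord_recl big_ord_recr /= subnn mulr0 mul0r add0r addr0.
rewrite natrD !natrM !mulr_natl natr_sum; congr (_ + _ *+ _).
apply: eq_bigr => i _; rewrite natrM /bump add1n.
by have -> : (n.+1 - i.+1)%N = (n - i.+1).+1 by have := ltn_ord i; lia.
Qed.

Local Open Scope nat_scope.

Lemma sum_fertility_asc (pats : seq (seq nat)) (o : seq nat -> nat) :
  all (avoids [:: 1]) pats ->
  (forall n w, 0 < n -> w \in permutations (iota 1 n) ->
    0 < o w <= last 0 w /\
    forall x, x \in iota 1 n.+1 -> all (avoids (insert_last w x)) pats =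
      all (avoids w) pats && ((x == n.+1) || (x == o w))) ->
  (forall w, all (avoids w) pats -> avoids3 pat312 w) ->
  stack_preimage_gf pats =1 asc_series.
Proof.
move=> H1 Ho H312 [|n] //; rewrite /stack_preimage_gf /= card_stack_preimage.
rewrite /asc_total -(sum_asc (Q := fun w => all (avoids w) pats) _ H1 Ho).
congr (_ %:R)%R; rewrite big_seq_cond [RHS]big_seq_cond; apply: eq_bigr => w /andP[wn /H312 Aw].
have [Uw sw _] := mem_perm_iota wn.
by rewrite asc_fertilityE ?sw.
Qed.

Lemma gf_132_312 :
  stack_preimage_gf [:: [:: 1; 3; 2]; [:: 3; 1; 2]] =1 asc_series.
Proof.
apply: (sum_fertility_asc (o := fun=> 1)); last by move=> w /avoids132_312[].
  by apply/avoids132_312; split; apply: avoids3_short.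
exact: insert_last_132_312.
Qed.

Lemma gf_231_312 :
  stack_preimage_gf [:: [:: 2; 3; 1]; [:: 3; 1; 2]] =1 asc_series.
Proof.
apply: (sum_fertility_asc (o := last 0)); last by move=> w /avoids231_312[].
  by apply/avoids231_312; split; apply: avoids3_short.
exact: insert_last_231_312.
Qed.

(** * V-shaped permutations *)

Fixpoint rev_valley (b : seq bool) : seq nat :=
  if b is x :: b' then
    let m := (size b').+2 in
    if x then rcons (rev_valley b') m else m :: rev_valley b'
  else [:: 1].

(* The V-shaped permutation in which bit [i] of [b] tells whether the entry
   [i + 2] stands to the right of [1]. *)
Definition valley (b : seq bool) : seq nat := rev_valley (rev b).

Lemma valley_rcons b x : valley (rcons b x) =
  if x then rcons (valley b) (size b).+2 else (size b).+2 :: valley b.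
Proof. by rewrite /valley rev_rcons /= size_rev. Qed.

Lemma valley_permutations b : valley b \in permutations (iota 1 (size b).+1).
Proof.
elim/last_ind: b => // b x; rewrite !mem_permutations => IHb.
have E m n : iota m n.+1 = rcons (iota m n) (m + n).
  by rewrite -addn1 iotaD cats1.
rewrite valley_rcons size_rcons E add1n; case: x.
  by rewrite perm_rcons perm_sym perm_rcons perm_cons perm_sym.
by rewrite perm_sym perm_rcons perm_cons perm_sym.
Qed.

Lemma valley_nseq b j :
  valley (b ++ nseq j true) = valley b ++ iota (size b).+2 j.
Proof.
elim: j => [|j IHj]; first by rewrite !cats0.
rewrite -addn1 nseqD catA cats1 valley_rcons IHj size_cat size_nseq.
by rewrite iotaD catA cats1.
Qed.

(** Both 132 and 231 have their largest letter in the middle, so a strict maximum at an end of the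
    word takes part in neither. *)
Lemma avoids_max_rcons (w : seq nat) (m : nat) : all (ltn^~ m) w ->
  all (avoids (rcons w m)) [:: [:: 1; 3; 2]; [:: 2; 3; 1]] =
  all (avoids w) [:: [:: 1; 3; 2]; [:: 2; 3; 1]].
Proof.
move=> /allP wm; apply/idP/idP => /avoids132_231; rewrite ?avoids3_rcons.
  by case=> -[A1 _] [A2 _]; apply/avoids132_231.
move=> [A1 A2]; apply/avoids132_231; rewrite !avoids3_rcons.
split; split=> // a b /mem_subseq2[/wm /= am /wm /= bm];
rewrite /pat132 /pat231; lia.
Qed.

Lemma avoids_max_cons (w : seq nat) (m : nat) : all (ltn^~ m) w ->
  all (avoids (m :: w)) [:: [:: 1; 3; 2]; [:: 2; 3; 1]] =
  all (avoids w) [:: [:: 1; 3; 2]; [:: 2; 3; 1]].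
Proof.
move=> /allP wm; apply/idP/idP => /avoids132_231[A1 A2]; apply/avoids132_231.
  by split; [apply: avoids3_subseq A1|apply: avoids3_subseq A2]; apply: subseq_cons.
split=> a b c /=; case: eqP => [->|_]; try by [apply: A1|apply: A2].
  move=> /mem_subseq2[/wm /= bm /wm /= cm]; rewrite /pat132; lia.
move=> /mem_subseq2[/wm /= bm /wm /= cm]; rewrite /pat231; lia.
Qed.

(** In this class the maximum stands at an end, and deleting it stays in the class; iterating yields
    the left/right code. *)
Lemma sum_valley (G : seq nat -> nat) n :
  \sum_(w <- permutations (iota 1 n.+1) |
    all (avoids w) [:: [:: 1; 3; 2]; [:: 2; 3; 1]]) G w =
  \sum_(b <- bits n) G (valley b).
Proof.
pose Q w := all (avoids w) [:: [:: 1; 3; 2]; [:: 2; 3; 1]].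
rewrite -[X in X = _]/(\sum_(w <- permutations (iota 1 n.+1) | Q w) G w).
elim: n G => [|n IHn] G.
  rewrite big_mkcond big_seq1 [RHS]big_seq1 ifT //.
  by apply/avoids132_231; split; apply: avoids3_short.
transitivity (\sum_(w <- permutations (iota 1 n.+1) | Q w)
    (G (rcons w n.+2) + G (n.+2 :: w))); last first.
  rewrite IHn sum_bitsS; apply: eq_big_seq => b /size_bits sb.
  by rewrite !valley_rcons sb.
rewrite -[LHS]big_filter -[RHS]big_filter big_split.
rewrite -(big_map (rcons^~ n.+2) xpredT G) -(big_map (cons n.+2) xpredT G) -big_cat.
have memS w : w \in [seq w <- permutations (iota 1 n.+1) | Q w] ->
    [/\ Q w, perm_eq w (iota 1 n.+1) & all (ltn^~ n.+2) w].
  rewrite mem_filter => /andP[Qw wn]; have [_ _ mw] := mem_perm_iota wn.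
  rewrite mem_permutations in wn; split=> //.
  by apply/allP => x; rewrite mw /=; lia.
have Eiota : iota 1 n.+2 = rcons (iota 1 n.+1) n.+2.
  by rewrite -[in LHS](addn1 n.+1) iotaD cats1.
apply/perm_big/uniq_perm.
- by rewrite filter_uniq ?permutations_uniq.
- rewrite cat_uniq !map_inj_uniq ?filter_uniq ?permutations_uniq //=.
  + rewrite andbT; apply/hasPn => _ /mapP[v /memS[_ _ vn] ->].
    apply/mapP => -[[|y w] /memS[_ wn lw]].
      by move/perm_size: wn.
    by case=> E _; move: lw; rewrite /= -E ltnn.
  + by move=> ? ? [].
  + exact: rcons_injl.
move=> w; rewrite mem_filter mem_permutations mem_cat Eiota; apply/andP/orP.
  move=> [Qw wn]; have mw : n.+2 \in w by rewrite (perm_mem wn) mem_rcons mem_head.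
  have back v : perm_eq v (iota 1 n.+1) -> Q v ->
      v \in [seq w <- permutations (iota 1 n.+1) | Q w].
    by move=> vn Qv; rewrite mem_filter Qv mem_permutations.
  have ltv v : perm_eq v (iota 1 n.+1) -> all (ltn^~ n.+2) v.
    by move=> vn; apply/allP => x; rewrite (perm_mem vn) mem_iota /=; lia.
  case/splitPr: mw Qw wn => w1 w2 Qw wn.
  have w12 : perm_eq (w1 ++ w2) (iota 1 n.+1).
    apply/permP => p; move/permP/(_ p): wn.
    by rewrite -cats1 !count_cat /=; lia.
  case: w2 Qw wn w12 => [|y w2] Qw wn w12.
    rewrite cats0 in w12; left; apply/mapP; exists w1; rewrite ?cats1 //.
    by apply: back => //; rewrite -/(Q _) /Q -(avoids_max_rcons (ltv _ w12)) -cats1.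
  case/lastP: w1 Qw wn w12 => [|w1 x] Qw wn w12.
    right; apply/mapP; exists (y :: w2) => //; apply: back => //.
    by rewrite /Q -(avoids_max_cons (ltv _ w12)).
  (* An interior maximum and its two neighbours [x], [y] would form 132 or 231. *)
  have /avoids132_231[A1 A2] := Qw.
  have sub : subseq [:: x; n.+2; y] (rcons w1 x ++ [:: n.+2, y & w2]).
    rewrite -cats1 -catA; apply: subseq_trans (suffix_subseq _ _).
    exact: (prefix_subseq [:: x; n.+2; y]).
  have := A1 _ _ _ sub; have := A2 _ _ _ sub; rewrite /pat132 /pat231.
  have /allP lt := ltv _ w12.
  have lx : x < n.+2 by apply: lt; rewrite !(mem_cat, mem_rcons) mem_head.
  have ly : y < n.+2 by apply: lt; rewrite mem_cat mem_head orbT.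
  have : x != y.
    have := perm_uniq w12; rewrite iota_uniq cat_uniq => /and3P[_ + _].
    by rewrite /= negb_or mem_rcons inE negb_or eq_sym => /andP[/andP[]].
  lia.
case=> /mapP[v /memS[Qv vn lv] ->].
  by rewrite /Q avoids_max_rcons // perm_rcons perm_sym perm_rcons perm_cons perm_sym.
by rewrite /Q avoids_max_cons // perm_sym perm_rcons perm_cons perm_sym.
Qed.

(** * Catalan numbers and fertilities of V-shaped permutations *)

Definition catalan (n : nat) : nat := fertility (iota 0 n).

Lemma fertility_iota a n : fertility (iota a n) = catalan n.
Proof.
rewrite -[a]addn0 iotaDl fertility_map ?iota_uniq // => x y.
exact: ltn_add2l.
Qed.

Lemma iotaSr a n : iota a n.+1 = rcons (iota a n) (a + n).
Proof. by rewrite -addn1 iotaD cats1. Qed.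

(** Factors of an increasing word are increasing, so [fertility_rcons] becomes the Catalan
    recursion. *)
Lemma catalanS n : catalan n.+1 = \sum_(i < n.+1) catalan i * catalan (n - i).
Proof.
rewrite {1}/catalan iotaSr add0n fertility_rcons ?size_iota; last first.
  by rewrite -[X in rcons _ X]add0n -iotaSr iota_uniq.
rewrite ifT; last by apply/allP => x; rewrite mem_iota.
apply: eq_bigr => i _; rewrite take_iota drop_iota !fertility_iota.
by rewrite (minn_idPl _) // -ltnS.
Qed.

Lemma fertility_last_lt (w : seq nat) (y : nat) :
  uniq w -> y \in w -> last 0 w < y -> fertility w = 0.
Proof.
case/lastP: w => // w x Uw; rewrite mem_rcons inE last_rcons => yw xy.
rewrite fertility_rcons // ifN //; apply/allPn; exists y.
  by case: (y =P x) yw xy => // ->; rewrite ltnn.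
by rewrite -leqNgt ltnW.
Qed.

Lemma size_valley b : size (valley b) = (size b).+1.
Proof. by have [_ ->] := mem_perm_iota (valley_permutations b). Qed.

Lemma fertility_valley_nseq j : fertility (valley (nseq j true)) = catalan j.+1.
Proof. by rewrite -[nseq j true]cat0s valley_nseq /= -(fertility_iota 1). Qed.

Lemma fertility_valley_false b : fertility (valley (rcons b false)) = 0.
Proof.
have [Ub sb mb] := mem_perm_iota (valley_permutations (rcons b false)).
move: Ub sb mb; rewrite valley_rcons size_rcons => Ub sb mb.
apply: (@fertility_last_lt _ (size b).+2) => //; first exact: mem_head.
have [_ sv mv] := mem_perm_iota (valley_permutations b).
have := last_mem (size b).+2 (w := valley b); rewrite sv mv => /(_ isT) /andP[_].
by rewrite /= -ltnS.
Qed.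

(** The word is [d], then [valley b], then an increasing run, and its last entry is the maximum. The
    rest is cut before [d], just after [d], or at or after the end of [valley b]; cuts inside
    [valley b] contribute 0. *)
Lemma fertility_valley_false_nseq b j :
  fertility (valley (rcons b false ++ nseq j.+1 true)) =
  fertility (valley (rcons b false ++ nseq j true)) +
  fertility (valley (b ++ nseq j true)) +
  \sum_(t < j.+1) fertility (valley (rcons b false ++ nseq t true)) * catalan (j - t).
Proof.
set d := (size b).+2.
pose u t := (d :: valley b) ++ iota d.+1 t.
have Eu t : valley (rcons b false ++ nseq t true) = u t.
  by rewrite valley_nseq valley_rcons size_rcons.
have Uu t : uniq (u t).
  by have [] := mem_perm_iota (valley_permutations (rcons b false ++ nseq t true));
     rewrite Eu.
have mu t x : (x \in u t) = (0 < x <= d + t).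
  have [_ _] := mem_perm_iota (valley_permutations (rcons b false ++ nseq t true)).
  by rewrite Eu => ->; rewrite size_cat size_rcons size_nseq.
have su t : size (u t) = d + t by rewrite size_cat /= size_valley size_iota.
have EuS t : u t.+1 = rcons (u t) (d.+1 + t) by rewrite /u iotaSr rcons_cat.
rewrite (Eu j.+1) EuS fertility_rcons -?EuS // ifT; last first.
  by apply/allP => x; rewrite mu /=; lia.
rewrite su -(big_mkord xpredT (fun i => fertility (take i (u j)) * fertility (drop i (u j)))).
rewrite big_ltn // big_ltn; last by rewrite /d; lia.
rewrite take0 drop0 fertility_nil mul1n addnA [in RHS]Eu; congr (_ + _ + _).
  rewrite /u /= take0 drop0.
  rewrite -[[:: d]]/(rcons [::] d) fertility_rcons // big_ord1 !fertility_nil !mul1n.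
  (* Without [d] the run starts at [d.+1]; relabelling by [bump d] matches it with the run of
     [valley (b ++ nseq j true)], which starts at [d]. *)
  rewrite valley_nseq -[RHS](@fertility_map (bump d)); last 2 first.
  - exact: bump_mono.
  - by rewrite /d -valley_nseq; have [] := mem_perm_iota (valley_permutations (b ++ nseq j true)).
  congr fertility; rewrite map_cat map_id_in; last first.
    move=> x; have [_ _ ->] := mem_perm_iota (valley_permutations b).
    by rewrite /bump /d; lia.
  congr (_ ++ _); rewrite -[in LHS](addn1 d) addnC iotaDl.
  by apply/eq_in_map => x; rewrite mem_iota /bump; lia.
rewrite (@big_cat_nat _ _ _ d) /=; [|by rewrite /d; lia|by rewrite /d; lia].
(* For [2 <= i < d] the left factor contains [d] but ends in a smaller entry of [valley b]. *)
rewrite big_nat big1 => [|i /andP[i2 id]]; last first.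
  rewrite [X in X * _](@fertility_last_lt _ d) //.
  - by have [] := uniq_take_drop i (Uu j).
  - by case: (i) i2 => // k _; rewrite /u /= mem_head.
  rewrite /u takel_cat /= ?size_valley; last by rewrite -/d ltnW.
  case: (i) i2 id => [|[|k]] // _ kd.
  have st : 0 < size (take k.+1 (valley b)).
    by rewrite size_take_min size_valley; move: kd; rewrite /d; lia.
  have := mem_take (last_mem d st).
  have [_ _ ->] := mem_perm_iota (valley_permutations b).
  by move=> /andP[_]; rewrite -ltnS /=.
(* A cut at [d + t] leaves [u t] on the left and an increasing word of length [j - t] on the
   right. *)
rewrite add0n -{1}[d]add0n big_addn (_ : (d + j).+1 - d = j.+1); last by lia.
rewrite big_mkord; apply: eq_bigr => t _; rewrite Eu.
have su' : size (d :: valley b) = d by rewrite /= size_valley.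
rewrite /u take_cat drop_cat su' ltnNge leq_addl /= addnK take_iota drop_iota.
by rewrite fertility_iota (minn_idPl _) // -ltnS.
Qed.

Local Open Scope ring_scope.

Definition catalan_series : fps := fun n => (catalan n)%:R.

Lemma catalan_series_eq : catalan_series = 1 + fpsX * catalan_series ^+ 2.
Proof.
apply: fpsP => -[|n]; rewrite fpsD_coef fps1_coef ?fpsX_mul0 ?fpsX_mulS.
  by rewrite addr0.
rewrite add0r expr2 fpsM_coef /catalan_series catalanS natr_sum.
by apply: eq_bigr => i _; rewrite natrM.
Qed.

Definition valley_series (b : seq bool) : fps :=
  fun j => (fertility (valley (b ++ nseq j true)))%:R.

Lemma valley_series_true b :
  valley_series (rcons b true) = fps_divX (valley_series b).
Proof. by apply: fpsP => j; rewrite /valley_series cat_rcons. Qed.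

(** The recursion says [(1 - x (1 + C)) F = x H], and [C = 1 + x C^2] gives
    [(1 - x (1 + C)) (C - 1) = x]; the common factor has constant term 1 and cancels. *)
Lemma valley_series_false b :
  valley_series (rcons b false) = (catalan_series - 1) * valley_series b.
Proof.
set C := catalan_series; set F := valley_series _; set H := valley_series b.
have EF : F = fpsX * (F + H + F * C).
  apply: fpsP => -[|j]; rewrite ?fpsX_mul0 ?fpsX_mulS.
    by rewrite /F /valley_series cats0 fertility_valley_false.
  rewrite {1}/F /valley_series fertility_valley_false_nseq !natrD natr_sum.
  rewrite 2!fpsD_coef fpsM_coef; congr (_ + _ + _).
  by apply: eq_bigr => i _; rewrite natrM.
have EC : C = 1 + fpsX * C ^+ 2 by exact: catalan_series_eq.
apply/eqP; rewrite -subr_eq0; apply/eqP.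
apply: (@fps_mulfI (1 - fpsX * (1 + C))).
  by rewrite fpsD_coef fpsN_coef fpsX_mul0 fps1_coef.
have -> : (1 - fpsX * (1 + C)) * (F - (C - 1) * H) =
  (F - fpsX * (F + H + F * C)) + (1 + fpsX * C ^+ 2 - C) * H by ring.
by rewrite -EF -EC !subrr mul0r addr0.
Qed.

Lemma gf_132_231 :
  stack_preimage_gf [:: [:: 1; 3; 2]; [:: 2; 3; 1]]%N =1 asc_series.
Proof.
pose c := catalan_series - 1.
have EC : catalan_series = 1 + c by rewrite /c addrC subrK.
have Ec : c = fpsX * (1 + c) ^+ 2.
  by rewrite -EC {1}/c {1}catalan_series_eq addrC addKr.
pose T n : fps := \sum_(b <- bits n) valley_series b.
have divX0 : fps_divX 0 = 0 by [].
have T0 : T 0%N = (1 + c) ^+ 2.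
  (* The empty code followed by [j] right choices is the increasing word of length [j.+1], so its
     series is [c] shifted by one. *)
  rewrite /T big_seq1 -[RHS]fps_divX_X -Ec /c.
  apply: fpsP => j; rewrite /valley_series cat0s fertility_valley_nseq.
  by rewrite /fps_divX fpsD_coef fpsN_coef fps1_coef subr0.
have TS n : T n.+1 = fps_divX (T n) + c * T n.
  rewrite /T big_cat !big_map (big_morph _ fps_divXD divX0) big_distrr /=.
  congr (_ + _); apply: eq_bigr => b _.
    exact: valley_series_true.
  exact: valley_series_false.
(* The constant term of [T n] allows no further right choices, so it sums the fertilities over the
   codes of length [n]. *)
move=> [|n] //; rewrite -(path_series_root Ec asc_series_eq T0 TS).
rewrite /stack_preimage_gf card_stack_preimage sum_valley natr_sum.
rewrite /T (big_morph (fun f : fps => f 0%N) (id1 := 0) (op1 := +%R)) //.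
by apply: eq_bigr => b _; rewrite /valley_series cats0.
Qed.

Theorem theorem4p1 :
  [/\ stack_preimage_gf [:: [:: 1; 3; 2]; [:: 3; 1; 2]]%N
        =1 stack_preimage_gf [:: [:: 2; 3; 1]; [:: 3; 1; 2]]%N,
      stack_preimage_gf [:: [:: 2; 3; 1]; [:: 3; 1; 2]]%N
        =1 stack_preimage_gf [:: [:: 1; 3; 2]; [:: 2; 3; 1]]%N
    & stack_preimage_gf [:: [:: 1; 3; 2]; [:: 2; 3; 1]]%N
        =1 fps_scale 4^-1
             (fps_divX
                (fps_sub (fps_of_poly (1 - 2 *: 'X))
                   (fps_sqrt (fps_of_poly (1 - 4 *: 'X - 4 *: 'X^2)))))].
Proof.
split=> n; rewrite ?gf_132_312 ?gf_231_312 ?gf_132_231 //.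
exact: fps_quadratic_root asc_series_eq n.
Qed.
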